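(* Let $L\ge2$, $S=1$, $\beta=1$, and $X\in[0,1]$. Let $(\phi_N)_{N\in\mathbb N}$ be a strictly increasing sequence of positive reals with $\phi_1^{-1}\le1/8$. For $\rho\in\{-1,+1\}$ let $\mathbb P_\rho$ be the distribution of $(X,Y)$ on $[0,1]\times\{0,1\}^L$ such that $X$ is distributed according to the Lebesgue measure on $[0,1]$, the labels $Y^1,\dots,Y^L$ are independent, $Y^l\equiv0$ for all $l=3,\dots,L$, and $$\mathbb P_\rho(Y^1=1\mid X)\equiv\tfrac34,\qquad \mathbb P_\rho(Y^2=1\mid X)\equiv\tfrac14-\rho\,\phi_N^{-1}.$$ If $\phi_N^{-1}$ decays sufficiently fast, then one can guarantee $\mathrm{TV}(\mathbb P_{+1}^{\otimes N},\mathbb P_{-1}^{\otimes N})\le 1/2$, and $$\inf_{\hat f}\ \sup_{\rho\in\{-1,+1\}}\ \mathbb E_{\mathbb P_\rho^{\otimes N}}\Big|\mathcal R_{\mathbb P_\rho}(\hat f)-\mathcal R_{\mathbb P_\rho}(f^{*}_{\rho})\Big|\ \ge\ \frac1{16L},$$ where the infimum is over all estimators $\hat f$ based on $N$ i.i.d. observations, and $f^*_\rho\in\arg\min_{f\in\mathcal F_{\beta}(\mathbb P_\rho)}\mathcal R_{\mathbb P_\rho}(f)$ with $\beta=1$. Moreover, the distributions $\mathbb P_{-1},\mathbb P_{+1}$ satisfy the local margin assumption and the sparsity assumption (with $S=1$); the corresponding regression functions are constant (in particular infinitely many times differentiable), the marginal distribution of $X$ admits a density with respect to the Lebesgue measure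 supported on $[0,1]$, and an estimator of the regression vector satisfying the exponential bound exists.
   Context: $[L]=\{1,\dots,L\}$. A classifier is a measurable function $f=(f^1,\dots,f^L)^\top:[0,1]\to\{0,1\}^L$. For a distribution $\mathbb P$ of $(X,Y)\in[0,1]\times\{0,1\}^L$, with $X$-marginal $\mathbb P_X$, the risk of $f$ is $$\mathcal R_{\mathbb P}(f)=\frac1L\sum_{l=1}^L\mathbb P\{f^l(X)=0,\ Y^l=1\},$$ and for $\beta\in[L]$, $$\mathcal F_\beta(\mathbb P)=\Big\{f \text{ classifier}:\ \sum_{l=1}^L\mathbb P\{f^l(X)=1,Y^l=0\mid X\}\le\beta,\ \mathbb P_X\text{-a.s.}\Big\}.$$ An estimator $\hat f$ is a map assigning a classifier to each data sample of $N$ i.i.d. observations with common distribution $\mathbb P$; the joint law of the data is $\mathbb P^{\otimes N}$ with expectation $\mathbb E_{\mathbb P^{\otimes N}}$. $\mathrm{TV}$ is the total variation distance between probability measures. The regression vector is $\eta(x)=(\eta^1(x),\dots,\eta^L(x))^\top$ with $\eta^l(x)=\mathbb P(Y^l=1\mid X=x)$; $\sigma=\sigma(x)$ is a permutation of $[L]$ with $\eta^{\sigma_1}(x)\ge\dots\ge\eta^{\sigma_L}(x)$; and $K(x)=\max\{m\in[L]:\sum_{l=1}^m(1-\eta^{\sigma_l}(x))\le\beta\}$. Local margin assumption: there exist constants $C_0>0$, $\alpha_1>0$ such that for all $\delta>0$ (and every $k$), $\mathbb P_X\{\eta^{\sigma_k}(X)-\eta^{\sigma_{k+1}}(X)\le\delta,\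 K(X)=k\}\le C_0\delta^{\alpha_1}$. Sparsity assumption: for a positive integer $S$ smaller than $L$, $\sum_{l=1}^L\mathbb P\{Y^l=1\mid X\}\le S$, $\mathbb P_X$-almost surely. Exponential bound for an estimator $\hat\eta$ of $\eta$: for some constants $C_1,C_2,\gamma>0$, for all $\delta>0$ and all $l\in[L]$, $\mathbb P^{\otimes N}\{|\eta^l(x)-\hat\eta^l(x)|\ge\delta\}\le C_1\exp(-C_2N^\gamma\delta^2)$ for $\mathbb P_X$-almost every $x$.
   Formalization: The sparsity assumption with S=1 is claimed only for P_{+1}; for P_{-1} it fails, since the conditional label probabilities sum to 1+1/φ_N > 1, so instead the exact sum 1−ρ/φ_N is stated for both ρ. *)

(* Defs.v *)
From HB Require Import structures.
From mathcomp Require Import all_boot all_order all_algebra all_fingroup.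
From mathcomp Require Import all_classical all_reals all_analysis.

Set Implicit Arguments.
Unset Strict Implicit.
Unset Printing Implicit Defensive.

Import Order.TTheory GRing.Theory Num.Theory.
Import numFieldNormedType.Exports.

Local Open Scope classical_set_scope.
Local Open Scope ring_scope.

Section ProductLaw.
Context d (T : measurableType d) (R : realType).

Definition tcons n (z : T * n.-tuple T) : n.+1.-tuple T := [tuple of z.1 :: z.2].

Lemma measurable_tcons n : measurable_fun [set: T * n.-tuple T] (@tcons n).
Proof. exact: measurable_cons. Qed.

HB.instance Definition _ n :=
  isMeasurableFun.Build _ _ _ _ (@tcons n) (@measurable_tcons n).

(* Law of an n-tuple of independent coordinates, the i-th one of law [P i]. *)
Fixpoint indep_law n : ('I_n -> probability T R) -> probability (n.-tuple T) R :=
  match n with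
  | 0 => fun _ => \d_([tuple] : 0.-tuple T)
  | m.+1 => fun P =>
      distribution (P ord0 \x indep_law (fun i => P (lift ord0 i)))%E (@tcons m)
  end.

Definition iid_law n (P : probability T R) : probability (n.-tuple T) R :=
  indep_law (fun _ : 'I_n => P).

End ProductLaw.

Arguments iid_law {d T R} n P.

Definition tv_dist d (T : measurableType d) (R : realType)
    (P Q : probability T R) : \bar R :=
  ereal_sup [set `|P A - Q A|%E | A in [set A : set T | measurable A]].

Definition signs (R : realType) : set R := [set -1; 1].
Arguments signs : clear implicits.

Section MultiLabel.
Context (R : realType) (L : nat).

(* Features take values in [0, 1], seen inside R: the law [model] below gives
   mass one to [0, 1] * {0,1}^L, and functions on [0, 1] are represented by
   functions on R, whose values outside [0, 1] are irrelevant.  The label Y^l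
   is [tnth y l], with 'I_L = {0, ..., L - 1} standing for {1, ..., L}. *)
Notation X := (measurableTypeR R).
Notation Y := (L.-tuple bool).
Notation Obs := (X * Y)%type.

Definition feature (z : Obs) : X := z.1.

Lemma measurable_feature : measurable_fun [set: Obs] feature.
Proof. exact: measurable_fst. Qed.

HB.instance Definition _ :=
  isMeasurableFun.Build _ _ _ _ feature measurable_feature.

Definition marginal (P : probability Obs R) : probability X R :=
  distribution P feature.

(* [g] is a version of the conditional probability P(E | X = x). *)
Definition cond_prob (P : probability Obs R) (E : set Obs) (g : X -> R) : Prop :=
  (marginal P).-integrable [set: X] (fun x => (g x)%:E) /\
  forall A : set X, measurable A ->
    (\int[marginal P]_(x in A) (g x)%:E = P ((feature @^-1` A) `&` E))%E.

Definition classifier (f : X -> Y) : Prop := measurable_fun [set: X] f.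

Definition risk (P : probability Obs R) (f : X -> Y) : R :=
  L%:R^-1 * \sum_(l < L)
    fine (P [set z : Obs | tnth (f z.1) l = false /\ tnth z.2 l = true]).

(* Since two versions of a conditional probability agree almost surely, the
   almost sure bound may be tested on any of them. *)
Definition fp_class (beta : nat) (P : probability Obs R) : set (X -> Y) :=
  [set f | classifier f /\
    exists g : 'I_L -> X -> R,
      (forall l, cond_prob P
         [set z : Obs | tnth (f z.1) l = true /\ tnth z.2 l = false] (g l)) /\
      {ae marginal P, forall x, \sum_(l < L) g l x <= beta%:R}].

Definition risk_argmin (beta : nat) (P : probability Obs R) : set (X -> Y) :=
  [set f | fp_class beta P f /\
    forall f', fp_class beta P f' -> risk P f <= risk P f'].

(* Estimators based on N observations. The only requirement beyond taking
   values in the classifiers is that the risk is a measurable function of the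
   sample, so that its expectation makes sense; every [fhat] that is jointly
   measurable in the sample and the feature satisfies it. *)
Definition estimator N (Theta : set R) (P : R -> probability Obs R) :
    set (N.-tuple Obs -> X -> Y) :=
  [set fhat | (forall D, classifier (fhat D)) /\
    forall rho, Theta rho ->
      measurable_fun [set: N.-tuple Obs] (fun D => risk (P rho) (fhat D))].

Definition minimax_excess_risk N (Theta : set R) (P : R -> probability Obs R)
    (fstar : R -> X -> Y) : \bar R :=
  ereal_inf
    [set ereal_sup
      [set (\int[iid_law N (P rho)]_D
              (`|risk (P rho) (fhat D) - risk (P rho) (fstar rho)|%R)%:E)%E
      | rho in Theta]
    | fhat in @estimator N Theta P].

Definition regression_vector (P : probability Obs R) (eta : 'I_L -> X -> R) : Prop :=
  forall l, cond_prob P [set z : Obs | tnth z.2 l = true] (eta l).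

(* [sigma x] sorts the regression vector at x in nonincreasing order; the
   k-th index sigma_k is [sigma x] at the ordinal k - 1. *)
Definition sorts (eta : 'I_L -> X -> R) (sigma : X -> {perm 'I_L}) : Prop :=
  forall x (i j : 'I_L), (i <= j)%N -> eta (sigma x j) x <= eta (sigma x i) x.

Definition Kmax (beta : nat) (eta : 'I_L -> X -> R) (sigma : X -> {perm 'I_L})
    (x : X) : nat :=
  \max_(1 <= m < L.+1 |
        \sum_(l < L | (l < m)%N) (1 - eta (sigma x l) x) <= beta%:R) m.

(* Here k = i + 1 and k + 1 = j + 1, for k = 1, ..., L - 1. *)
Definition local_margin (beta : nat) (P : probability Obs R)
    (eta : 'I_L -> X -> R) (C0 alpha1 : R) : Prop :=
  forall sigma, sorts eta sigma ->
  forall delta : R, 0 < delta ->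
  forall i j : 'I_L, j = i.+1 :> nat ->
    (marginal P [set x | (eta (sigma x i) x - eta (sigma x j) x <= delta)%R /\
                         Kmax beta eta sigma x = i.+1]
     <= (C0 * delta `^ alpha1)%:E)%E.

Definition sparse (S : nat) (P : probability Obs R) (eta : 'I_L -> X -> R) : Prop :=
  (0 < S < L)%N /\ {ae marginal P, forall x, \sum_(l < L) eta l x <= S%:R}.

Definition exponential_bound N (P : probability Obs R) (eta : 'I_L -> X -> R)
    (etahat : N.-tuple Obs -> 'I_L -> X -> R) (C1 C2 gamma : R) : Prop :=
  forall delta : R, 0 < delta -> forall l : 'I_L,
    {ae marginal P, forall x,
      (iid_law N P [set D | (delta <= `|eta l x - etahat D l x|)%R]
       <= (C1 * expR (- (C2 * N%:R `^ gamma * delta ^+ 2)))%:E)%E}.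

(* Conditional probabilities of the labels under P_rho, with eps = 1 / phi_N. *)
Definition label_prob (rho eps : R) (l : 'I_L) : R :=
  match val l with
  | 0 => 3 / 4
  | 1 => 1 / 4 - rho * eps
  | _ => 0
  end.

(* P_rho: X is uniform on [0, 1] and, given X, the labels are independent
   Bernoulli variables of parameters [label_prob rho eps l].  Note that these
   parameters sum to 1 - rho * eps, which exceeds 1 for rho = -1. *)
Definition model (eps rho : R) : probability Obs R :=
  (uniform_prob (@ltr01 R) \x
   indep_law (fun l => bernoulli_prob (label_prob rho eps l)))%E.

Definition model_eta (eps rho : R) : 'I_L -> X -> R :=
  fun l _ => label_prob rho eps l.

End MultiLabel.

Arguments model {R} L eps rho.
Arguments model_eta {R} L eps rho l x.
Arguments label_prob {R} L rho eps l.

(* Main.v *)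
(** Only label 2 distinguishes P_{+1} from P_{-1}, and on each of its two values
    the likelihoods differ by a factor at most 1 + 16 eps, where eps = 1 / phi_N.
    Domination of measures up to a constant tensorizes, so the N-sample laws
    dominate each other up to (1 + 16 eps)^N, which stays below 3/2 as soon as
    eps is of order 1 / N; this bounds both the total variation distance and the
    change of measure in Le Cam's two-point argument.
    The constraint [beta = 1] lets one predict labels 1 and 2 together exactly
    when rho = -1: the optimal risk is 0 for rho = -1 and (1/4 - eps) / L for
    rho = +1, whereas no single classifier has risks under the two laws close to
    both values. The exponential bound comes from Chernoff's method applied to
    empirical frequencies, with 1 + x + 2 x^2 as an upper bound of exp x for
    x <= 1/2. *)

Require Import Defs.
From HB Require Import structures.
From mathcomp Require Import all_boot all_order all_algebra all_fingroup.
From mathcomp Require Import all_classical all_reals all_analysis.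
From mathcomp Require Import measurable_realfun ring lra.

Set Implicit Arguments.
Unset Strict Implicit.
Unset Printing Implicit Defensive.

Import Order.TTheory GRing.Theory Num.Theory.
Import numFieldNormedType.Exports.

Local Open Scope classical_set_scope.
Local Open Scope ring_scope.

(** * Domination of measures up to a constant, its tensorization and total variation *)

Section Domination.
Context (R : realType).

(** This is the bound [dP/dQ <= c] stated without densities. Bare set functions let probabilities
    and product measures fit alike. *)
Definition dominated_by d (T : measurableType d) (c : R)
    (P Q : set T -> \bar R) : Prop :=
  forall A, measurable A -> (P A <= c%:E * Q A)%E.

Lemma dominated_refl d (T : measurableType d) (P : set T -> \bar R) :
  dominated_by 1 P P.
Proof. by move=> A _; rewrite mul1e. Qed.

Lemma ge0_le_integral_dominated d (T : measurableType d) (c : R)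
    (P Q : {measure set T -> \bar R}) (f : T -> \bar R) :
  0 <= c -> dominated_by c P Q ->
  measurable_fun setT f -> (forall x, 0 <= f x)%E ->
  (\int[P]_x f x <= c%:E * \int[Q]_x f x)%E.
Proof.
move=> c0 PQ mf f0.
have -> : c%:E = (NngNum c0)%:num%:E by [].
rewrite -ge0_integral_mscale//.
by apply: ge0_le_measure_integral => // S mS; exact: PQ.
Qed.

(** A product measure integrates the measures of sections, so the outer measure can be exchanged
    first, at cost [a], and then the inner one section by section, at cost [b]. *)
Lemma dominated_product d1 d2 (T1 : measurableType d1) (T2 : measurableType d2)
    (a b : R) (P1 Q1 : {measure set T1 -> \bar R})
    (P2 Q2 : {sigma_finite_measure set T2 -> \bar R}) :
  0 <= a -> 0 <= b -> dominated_by a P1 Q1 -> dominated_by b P2 Q2 ->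
  dominated_by (a * b) (P1 \x P2)%E (Q1 \x Q2)%E.
Proof.
move=> a0 b0 PQ1 PQ2 A mA; rewrite /product_measure1 EFinM.
have mxs (m : {sigma_finite_measure set T2 -> \bar R}) :
    measurable_fun setT (m \o xsection A).
  exact: measurable_fun_xsection.
apply: (le_trans (ge0_le_integral_dominated a0 PQ1 (mxs P2) _)) => //.
rewrite -muleA; apply: lee_wpmul2l; first by rewrite lee_fin.
rewrite -ge0_integralZl//.
apply: ge0_le_integral => //.
- by apply: measurable_funeM; exact: mxs.
- by move=> x _; apply: PQ2; exact: measurable_xsection.
Qed.

(** The constant depends on the coordinate, so that coordinates with equal laws cost a factor 1 and
    only the second label is paid for. *)
Lemma dominated_indep_law d (T : measurableType d) n
    (c : 'I_n -> R) (P Q : 'I_n -> probability T R) :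
  (forall i, 0 <= c i) -> (forall i, dominated_by (c i) (P i) (Q i)) ->
  dominated_by (\prod_i c i) (indep_law P) (indep_law Q).
Proof.
elim: n => [|n IH] in c P Q *.
  by move=> _ _ A mA; rewrite big_ord0 mul1e.
move=> c0 PQ A mA; rewrite big_ord_recl.
apply: (@dominated_product _ _ _ _ _ _ (P ord0) (Q ord0)
  (indep_law (fun i => P (lift ord0 i)))
  (indep_law (fun i => Q (lift ord0 i)))) => //.
- by apply: prodr_ge0.
- by apply: IH => i.
- by rewrite -[X in measurable X]setTI; exact: measurable_tcons.
Qed.

Lemma dominated_iid_law d (T : measurableType d) n (c : R)
    (P Q : probability T R) : 0 <= c -> dominated_by c P Q ->
  dominated_by (c ^+ n) (iid_law n P) (iid_law n Q).
Proof.
move=> c0 PQ; rewrite -[n in c ^+ n]card_ord -prodr_const.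
exact: dominated_indep_law.
Qed.

(** From [p <= c * q] and [q <= 1] one gets [p - q <= (c - 1) * q <= c - 1], and symmetrically. *)
Lemma tv_dist_dominated d (T : measurableType d) (c : R)
    (P Q : probability T R) : 1 <= c ->
  dominated_by c P Q -> dominated_by c Q P ->
  (tv_dist P Q <= (c - 1)%:E)%E.
Proof.
move=> c1 PQ QP; apply: ge_ereal_sup => _ [A mA <-].
have pq := PQ _ mA; have qp := QP _ mA.
have p1 : (P A <= 1)%E := probability_le1 P mA.
have q1 : (Q A <= 1)%E := probability_le1 Q mA.
have Pp : P A = (fine (P A))%:E by rewrite fineK// fin_num_measure.
have Qq : Q A = (fine (Q A))%:E by rewrite fineK// fin_num_measure.
move: pq qp p1 q1; rewrite Pp Qq.
move: (fine (P A)) (fine (Q A)) => p q {Pp Qq}.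
rewrite -!EFinM -EFinB !lee_fin => pq qp p1 q1.
rewrite ler_norml; apply/andP; split.
  have : 0 <= (c - 1) * (1 - p) by apply: mulr_ge0; lra.
  by lra.
have : 0 <= (c - 1) * (1 - q) by apply: mulr_ge0; lra.
by lra.
Qed.

End Domination.

(** * Coordinates and product integrals under independent laws *)

Section IndepLaw.
Context d (T : measurableType d) (R : realType).

Lemma indep_lawS n (P : 'I_n.+1 -> probability T R) A :
  indep_law P A =
  (P ord0 \x indep_law (fun i => P (lift ord0 i)))%E (@tcons _ T n @^-1` A).
Proof. by []. Qed.

Lemma indep_law_tnth n (P : 'I_n -> probability T R) (i : 'I_n) (B : set T) :
  measurable B -> indep_law P [set y | B (tnth y i)] = P i B.
Proof.
move=> mB; elim: n => [|n IH] in P i *; first by case: i.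
rewrite indep_lawS; have [j ->|->] := unliftP ord0 i.
  (* For a later coordinate the event is a rectangle with full first side, which leaves the
     induction hypothesis; for the first coordinate the other side is full. *)
  transitivity ((P ord0 \x indep_law (fun i => P (lift ord0 i)))%E
      (setT `*` [set y : n.-tuple T | B (tnth y j)])).
    congr (_ _); apply/seteqP; split => [[x y]|[x y]] /=;
      by rewrite /tcons/= tnthS//= => -[].
  rewrite product_measure1E//; last first.
    by rewrite -[X in measurable X]setTI; exact: measurable_tnth.
  by rewrite [X in (X * _)%E](probability_setT (P ord0)) mul1e; exact: IH.
transitivity ((P ord0 \x indep_law (fun i => P (lift ord0 i)))%E
    (B `*` [set: n.-tuple T])).
  by congr (_ _); apply/seteqP; split => [[x y]|[x y]] //= -[].
by rewrite product_measure1E// [X in (_ * X)%E]probability_setT mule1.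
Qed.

(** Induction on the sample size with Tonelli: the factor of the first observation leaves the inner
    integral, and the remaining integral leaves the outer one. *)
Lemma integral_iid_law_prod n (P : probability T R) (g : T -> R) :
  measurable_fun setT g -> (forall x, 0 <= g x) ->
  (\int[iid_law n P]_D (\prod_(i < n) g (tnth D i))%:E =
   \prod_(i < n) \int[P]_x (g x)%:E)%E.
Proof.
move=> mg g0.
have mprod m : measurable_fun [set: m.-tuple T]
    (fun D => (\prod_(i < m) g (tnth D i))%:E).
  apply/measurable_EFinP; apply: measurable_prod => i _.
  by apply: measurableT_comp => //; exact: measurable_tnth.
have p0 m (D : m.-tuple T) : (0 <= (\prod_(i < m) g (tnth D i))%:E)%E.
  by rewrite lee_fin prodr_ge0.
elim: n => [|n IH].
  rewrite big_ord0 /iid_law/= integral_dirac//= ?diracT ?mul1e ?big_ord0//.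
  exact: mprod.
rewrite big_ord_recl -IH /iid_law/=.
rewrite ge0_integral_pushforward//=; last first.
- by move=> D _; exact: p0.
- exact: mprod.
rewrite fubini_tonelli1//=; last 2 first.
- exact: (measurableT_comp (mprod n.+1) (@measurable_tcons _ T n)).
- by move=> z; exact: p0.
rewrite /fubini_F/=.
under eq_integral => x _.
  under eq_integral => y _.
    rewrite big_ord_recl/= EFinM (_ : tnth _ ord0 = x)//.
    under eq_bigr do rewrite tnthS.
    over.
  rewrite ge0_integralZl//=; last 3 first.
  - exact: mprod.
  - by move=> y _; exact: p0.
  - by rewrite lee_fin.
  over.
rewrite ge0_integralZr//=.
- exact/measurable_EFinP.
- by move=> x _; rewrite lee_fin.
- by apply: integral_ge0 => D _; exact: p0.
Qed.

End IndepLaw.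

(** * Chernoff bounds for empirical frequencies *)

Section Chernoff.
Context (R : realType).

(** Inverting [1 - x <= expR (- x)] bounds [expR x] by [1 / (1 - x)], and [(1 - x) * (1 + x + 2 * x
    ^+ 2) = 1 + x ^+ 2 * (1 - 2 * x)] is at least 1. *)
Lemma expR_le_1Dx2 (x : R) : x <= 1 / 2 -> expR x <= 1 + x + 2 * x ^+ 2.
Proof.
move=> x12; have := expR_ge1Dx (- x); rewrite expRN => h.
have e0 := expR_gt0 x; have x1 : 0 < 1 - x by lra.
have : expR x * (1 - x) <= 1 by rewrite mulrC -ler_pdivlMr// div1r.
have : 1 <= (1 - x) * (1 + x + 2 * x ^+ 2) by nra.
by move=> h1 h2; rewrite -(ler_pM2r x1) (le_trans h2)// mulrC.
Qed.

Lemma markov_ge0 d (T : measurableType d) (mu : {measure set T -> \bar R})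
    (f : T -> R) (c : R) :
  measurable_fun setT f -> (forall x, 0 <= f x) -> 0 <= c ->
  (c%:E * mu [set x | (c <= f x)%R] <= \int[mu]_x (f x)%:E)%E.
Proof.
move=> mf f0 c0.
have mE : measurable [set x | c <= f x].
  rewrite (_ : [set _ | _] = f @^-1` `[c, +oo[%classic); last first.
    by apply/seteqP; split => x /=; rewrite in_itv/= andbT.
  by rewrite -[X in measurable X]setTI; exact: mf.
rewrite -integral_cst//.
apply: (@le_trans _ _ (\int[mu]_(x in [set x | (c <= f x)%R]) (f x)%:E)%E).
  apply: ge0_le_integral => //.
  exact/measurable_EFinP/measurable_funTS.
apply: ge0_subset_integral => //; first exact/measurable_EFinP.
by move=> x _; rewrite lee_fin.
Qed.

Context d (T : measurableType d).

(** The centred indicator takes two values, so its moment generating function is a two-term sum, to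
    which the quadratic bound on the exponential applies. *)
Lemma integral_expR_indic (P : probability T R) (E : set T) (p t : R) :
  measurable E -> P E = p%:E -> `|t| <= 1 / 2 ->
  (\int[P]_x (expR (t * (\1_E x - p)))%:E <= (expR (2 * t ^+ 2))%:E)%E.
Proof.
move=> mE PE t12.
have [p0 p1] : 0 <= p /\ p <= 1.
  by split; rewrite -lee_fin -PE ?measure_ge0 ?probability_le1.
under eq_integral => x _.
  rewrite (_ : (expR (t * (\1_E x - p)))%:E =
    ((expR (t * (1 - p)))%:E * (\1_E x)%:E +
     (expR (t * (0 - p)))%:E * (\1_(~` E) x)%:E)%E); last first.
    rewrite !indicE in_setC; case: (x \in E) => /=;
      by rewrite ?mule0 ?mule1 ?adde0 ?add0e.
  over.
have e0 x : (0 <= (expR x)%:E :> \bar R)%E by rewrite lee_fin expR_ge0.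
have mE' : measurable (~` E) by exact: measurableC.
have mi (B : set T) : measurable B ->
    measurable_fun [set: T] (fun x => (\1_B x)%:E : \bar R).
  by move=> mB; apply/measurable_EFinP; exact: measurable_indic.
have i0 (B : set T) x : (0 <= (\1_B x)%:E :> \bar R)%E by rewrite lee_fin.
rewrite ge0_integralD//; last 2 first.
- by apply: measurable_funeM; exact: mi.
- by apply: measurable_funeM; exact: mi.
rewrite (ge0_integralZl P measurableT (mi _ mE))//.
rewrite (ge0_integralZl P measurableT (mi _ mE'))//.
have -> : (\int[P]_x (\1_E x)%:E = p%:E)%E.
  by rewrite integral_indic// setIT; exact: PE.
have -> : (\int[P]_x (\1_(~` E) x)%:E = (1 - p)%:E)%E.
  rewrite integral_indic// setIT; apply: etrans (probability_setC P mE) _.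
  by rewrite PE.
rewrite -!EFinM -EFinD.
rewrite lee_fin.
have := expR_ge1Dx (2 * t ^+ 2).
have [t1 t2] : - (1/2) <= t /\ t <= 1/2.
  by move: t12; rewrite ler_norml => /andP[].
have := @expR_le_1Dx2 (t * (1 - p)); have := @expR_le_1Dx2 (t * (0 - p)).
move: (expR _) (expR _) (expR _) => a b c.
have h1 : t * (0 - p) <= 1 / 2 by nra.
have h2 : t * (1 - p) <= 1 / 2 by nra.
move=> /(_ h1) ha /(_ h2) hb hc; apply: le_trans hc.
(* The linear terms cancel by centring; the quadratic ones add up to [2 * t ^+ 2] times the variance
   [p * (1 - p)]. *)
apply: (@le_trans _ _ (1 + 2 * t ^+ 2 * (p * (1 - p)))).
  have := ler_wpM2l p0 hb; have p1' : 0 <= 1 - p by lra.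
  by have := ler_wpM2l p1' ha; lra.
have : 0 <= t ^+ 2 by exact: sqr_ge0.
by move: (t ^+ 2) => s s0; nra.
Qed.

Definition empirical_freq n (E : set T) (D : n.-tuple T) : R :=
  n%:R^-1 * \sum_(i < n) \1_E (tnth D i).

(** The sign of [t] selects the tail. The threshold is twice the exponent [2 * t ^+ 2 * n%:R] of the
    moment bound, so Markov's inequality leaves exactly its negative. *)
Lemma chernoff_one_sided n (P : probability T R) (E : set T) (p t : R) :
  measurable E -> P E = p%:E -> `|t| <= 1 / 2 ->
  (iid_law n P [set D | (4 * t ^+ 2 * n%:R <=
       t * \sum_(i < n) (\1_E (tnth D i) - p))%R]
   <= (expR (- (2 * t ^+ 2 * n%:R)))%:E)%E.
Proof.
move=> mE PE t12.
pose g x : R := expR (t * (\1_E x - p)).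
have mg : measurable_fun [set: T] g.
  apply: measurableT_comp => //; apply: measurable_funM => //.
  by apply: measurable_funB => //; exact: measurable_indic.
have g0 x : 0 <= g x by exact: expR_ge0.
pose W (D : n.-tuple T) : R := \prod_(i < n) g (tnth D i).
have mW : measurable_fun setT W.
  apply: measurable_prod => i _.
  by apply: measurableT_comp => //; exact: measurable_tnth.
have WE D : W D = expR (t * \sum_(i < n) (\1_E (tnth D i) - p)).
  by rewrite /W /g mulr_sumr expR_sum.
have W0 D : 0 <= W D by rewrite WE expR_ge0.
have IW : (\int[iid_law n P]_D (W D)%:E <= (expR (2 * t ^+ 2 * n%:R))%:E)%E.
  rewrite integral_iid_law_prod//.
  have := integral_expR_indic mE PE t12; rewrite -/(g _).
  have : (0 <= \int[P]_x (g x)%:E)%E by apply: integral_ge0 => x _; rewrite lee_fin.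
  case: (\int[P]_x (g x)%:E)%E => [a||]//; rewrite !lee_fin => a0 ae.
  rewrite prodEFin lee_fin prodr_const card_ord.
  by rewrite mulrC expRM_natl lerXn2r// nnegrE expR_ge0.
have := markov_ge0 (iid_law n P) mW W0 (expR_ge0 (4 * t ^+ 2 * n%:R)).
rewrite (_ : [set x | _ <= W x] = [set D | (4 * t ^+ 2 * n%:R <=
    t * \sum_(i < n) (\1_E (tnth D i) - p))%R]); last first.
  by apply/seteqP; split => D /=; rewrite WE ler_expR.
move=> /le_trans /(_ IW).
rewrite (_ : - (2 * _ * _) = 2 * t ^+ 2 * n%:R - 4 * t ^+ 2 * n%:R); last lra.
move=> h; rewrite expRB EFinM [leRHS]muleC.
by rewrite lee_pdivlMl ?expR_gt0.
Qed.

Lemma chernoff_empirical_freq n (P : probability T R) (E : set T) (p delta : R) :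
  (0 < n)%N -> measurable E -> P E = p%:E -> 0 < delta ->
  (iid_law n P [set D | (delta <= `|p - empirical_freq E D|)%R]
   <= (2 * expR (- (8^-1 * n%:R * delta ^+ 2)))%:E)%E.
Proof.
move=> n0 mE PE d0.
have nR : 0 < n%:R :> R by rewrite ltr0n.
have [p0 p1] : 0 <= p /\ p <= 1.
  by split; rewrite -lee_fin -PE ?measure_ge0 ?probability_le1.
pose S (D : n.-tuple T) : R := \sum_(i < n) (\1_E (tnth D i) - p).
have SE D : empirical_freq E D - p = n%:R^-1 * S D.
  rewrite /S sumrB sumr_const card_ord /empirical_freq mulrBr.
  by rewrite -[p *+ n]mulr_natl mulKf// gt_eqF.
have mS : measurable_fun setT S.
  apply: measurable_sum => i; apply: measurable_funB => //.
  by apply: measurableT_comp (measurable_tnth i) => //; exact: measurable_indic.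
pose B t := [set D : n.-tuple T | 4 * t ^+ 2 * n%:R <= t * S D].
have mB t : measurable (B t).
  rewrite (_ : B t = (fun D => t * S D) @^-1` `[4 * t ^+ 2 * n%:R, +oo[%classic).
    by rewrite -[X in measurable X]setTI; exact: measurable_funM.
  by apply/seteqP; split => D /=; rewrite in_itv/= andbT.
(* A frequency and a probability differ by at most 1, so the event is empty for [delta > 1];
   otherwise [delta / 4] is an admissible [t]. *)
have [d1|d1] := leP delta 1; last first.
  rewrite (_ : [set _ | _] = set0) ?measure0 ?lee_fin ?mulr_ge0 ?expR_ge0//.
  apply/seteqP; split => // D /= h.
  have : `|empirical_freq E D - p| <= 1.
    rewrite SE normrM gtr0_norm ?invr_gt0// ler_pdivrMl// mulr1.
    apply: le_trans (ler_norm_sum _ _ _) _.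
    rewrite -[X in _ <= X%:R](card_ord n) -sum1_card natr_sum; apply: ler_sum => i _.
    rewrite indicE ler_norml; case: (_ \in E) => /=; apply/andP; split; lra.
  by rewrite distrC => h1; have := lt_le_trans d1 (le_trans h h1); rewrite ltxx.
(* With [t = delta / 4] the threshold [4 * t ^+ 2 * n%:R] equals [t * (n%:R * delta)], and
   [2 * t ^+ 2 = delta ^+ 2 / 8] gives the constant of the exponent. *)
apply: (@le_trans _ _ (iid_law n P (B (delta / 4) `|` B (- (delta / 4))))).
  apply: le_measure; rewrite ?inE.
  - rewrite (_ : [set _ | _] =
        (fun D => `|n%:R^-1 * S D|) @^-1` `[delta, +oo[%classic).
      rewrite -[X in measurable X]setTI.
      have : measurable_fun setT (fun D => `|n%:R^-1 * S D|).
        by apply: measurableT_comp => //; exact: measurable_funM.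
      by apply.
    by apply/seteqP; split => D /=; rewrite in_itv/= andbT -SE distrC.
  - exact: measurableU.
  - move=> D /=; rewrite distrC SE normrM gtr0_norm ?invr_gt0//.
    rewrite ler_pdivlMl// ler_normr /B/= => /orP[|] h; [left|right]; nra.
apply: (le_trans (measureU2 _ _ _)) => //.
rewrite (_ : (2 * _)%:E = ((expR (- (8^-1 * n%:R * delta ^+ 2)))%:E +
  (expR (- (8^-1 * n%:R * delta ^+ 2)))%:E)%E); last by rewrite -EFinD mulr_natl.
have d4 : `|delta / 4| <= 1 / 2 by rewrite ger0_norm; lra.
apply: leeD; apply: (le_trans (chernoff_one_sided n mE PE _)) => //;
  rewrite ?normrN// lee_fin ler_expR; lra.
Qed.
End Chernoff.

(** * Bernoulli laws *)

Section Bernoulli.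
Context (R : realType).

Lemma bernoulli_prob_set1 (p : R) (b : bool) : 0 <= p <= 1 ->
  bernoulli_prob p [set b] = (if b then p else 1 - p)%:E.
Proof.
have memE b' : (b' \in [set b]) = (b' == b) by apply/idP/eqP; rewrite inE.
move=> p01; rewrite bernoulli_probE// !diracE !memE.
by case: b {memE} => /=; rewrite ?mule0 ?mule1 ?adde0 ?add0e.
Qed.

Lemma dominated_bernoulli (p q c : R) : 0 <= p <= 1 -> 0 <= q <= 1 ->
  p <= c * q -> 1 - p <= c * (1 - q) ->
  dominated_by c (bernoulli_prob p) (bernoulli_prob q).
Proof.
move=> p01 q01 pq pq' A _; rewrite !bernoulli_probE// !diracE.
rewrite -[X in (_ + X%:E * _ <= _)%E]/(1 - p).
rewrite -[X in (_ <= _ * (_ + X%:E * _))%E]/(1 - q) -!EFinM -!EFinD.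
rewrite lee_fin.
by case: (_ \in A); case: (_ \in A) => /=;
  rewrite !(mulr0, mulr1, addr0, add0r); lra.
Qed.

End Bernoulli.

(** * The two-point model: domination, risks and the false positive constraint *)

Section Model.
Context (R : realType) (L : nat).
Implicit Types (eps rho : R) (l : 'I_L).
Notation U := (@uniform_prob R 0 1 ltr01).

Lemma signsP rho : signs R rho <-> rho = -1 \/ rho = 1.
Proof. by []. Qed.

Lemma label_prob_bounds rho eps l :
  signs R rho -> 0 <= eps <= 1 / 8 -> 0 <= label_prob L rho eps l <= 1.
Proof.
move=> /signsP rho1 /andP[e0 e8]; rewrite /label_prob.
by case: (val l) => [|[|?]]; [|case: rho1 => ->|]; lra.
Qed.

(* [1/4 + eps <= (1 + 16 eps) (1/4 - eps)] is where [eps <= 1/8] is used. *)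
Lemma dominated_model eps rho rho' :
  signs R rho -> signs R rho' -> 0 <= eps <= 1 / 8 ->
  dominated_by (1 + 16 * eps) (model L eps rho) (model L eps rho').
Proof.
move=> s s' eps01; have /andP[e0 e8] := eps01.
pose c (i : 'I_L) := if val i == 1%N then 1 + 16 * eps else 1.
have c0 i : 0 <= c i by rewrite /c; case: ifP => _; lra.
(* Only an upper bound, since for [L < 2] the second label is absent and the product is 1. *)
have prodc : 0 <= \prod_i c i <= 1 + 16 * eps.
  rewrite prodr_ge0//=.
  have [/existsP[i /eqP i1]|/existsPn noi] := boolP [exists i : 'I_L, val i == 1%N].
    rewrite (bigD1 i)//= /c i1/= big1 ?mulr1//= => j ji.
    by rewrite -i1 val_eqE (negbTE ji).
  by rewrite big1; [lra|move=> i _; rewrite /c (negbTE (noi i))].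
move=> A mA.
have : dominated_by (1 * \prod_i c i) (model L eps rho) (model L eps rho').
  apply: dominated_product => //.
  - by case/andP: prodc.
  - exact: dominated_refl.
  - apply: dominated_indep_law => // i.
    apply: dominated_bernoulli; try exact: label_prob_bounds.
      rewrite /c /label_prob; case: (val i) => [|[|?]] /=; try lra.
      move: s s' => /signsP[] -> /signsP[] ->; nra.
    rewrite /c /label_prob; case: (val i) => [|[|?]] /=; try lra.
    move: s s' => /signsP[] -> /signsP[] ->; nra.
move=> /(_ A mA) /le_trans; apply.
by rewrite mul1r lee_wpmul2r// lee_fin; case/andP: prodc.
Qed.

Lemma marginal_model eps rho (A : set (measurableTypeR R)) :
  measurable A -> marginal (model L eps rho) A = U A.
Proof.
move=> mA.
transitivity (model L eps rho (A `*` [set: L.-tuple bool])).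
  by congr (model _ _ _ _); apply/seteqP; split => [[x y]|[x y]] //= [].
by rewrite [LHS]product_measure1E// [X in (_ * X)%E]probability_setT mule1.
Qed.

Lemma model_label eps rho (A : set (measurableTypeR R)) l b :
  signs R rho -> 0 <= eps <= 1 / 8 -> measurable A ->
  model L eps rho [set z | A z.1 /\ tnth z.2 l = b] =
  (U A * (if b then label_prob L rho eps l else 1 - label_prob L rho eps l)%:E)%E.
Proof.
move=> s e mA.
transitivity (model L eps rho (A `*` [set y : L.-tuple bool | [set b] (tnth y l)])).
  by congr (_ _); apply/seteqP; split => [[x y]|[x y]].
rewrite [LHS]product_measure1E//; last first.
  by rewrite -[X in measurable X]setTI; exact: measurable_tnth.
rewrite [X in (_ * X)%E]indep_law_tnth//.
by rewrite [X in (_ * X)%E]bernoulli_prob_set1//; exact: label_prob_bounds.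
Qed.

(** As labels are independent of the feature in the model, the risk depends on a classifier only
    through these numbers. *)
Definition miss (f : measurableTypeR R -> L.-tuple bool) l : R :=
  fine (U [set x | tnth (f x) l = false]).

Lemma measurable_classifier_tnth (f : measurableTypeR R -> L.-tuple bool) l b :
  classifier f -> measurable [set x | tnth (f x) l = b].
Proof.
move=> mf.
have : measurable_fun setT (fun x => tnth (f x) l).
  exact: (measurableT_comp (measurable_tnth l) mf).
by move=> /(_ measurableT [set b] I); rewrite setTI.
Qed.

Lemma miss_bounds f l : classifier f -> 0 <= miss f l <= 1.
Proof.
move=> mf; have mA := measurable_classifier_tnth l false mf.
rewrite /miss -!lee_fin fineK ?fin_num_measure//.
by rewrite measure_ge0 probability_le1.
Qed.

Lemma risk_model eps rho f :
  signs R rho -> 0 <= eps <= 1 / 8 -> classifier f ->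
  risk (model L eps rho) f =
  L%:R^-1 * \sum_(l < L) miss f l * label_prob L rho eps l.
Proof.
move=> s e mf; congr (_ * _); apply: eq_bigr => l _.
have mA := measurable_classifier_tnth l false mf.
rewrite [X in fine X](@model_label eps rho [set x | tnth (f x) l = false] l true)//.
by rewrite fineM// fin_num_measure.
Qed.

Lemma cond_prob_cst eps rho E c :
  (forall B, measurable B ->
     model L eps rho ((@feature R L @^-1` B) `&` E) = (U B * c%:E)%E) ->
  cond_prob (model L eps rho) E (fun=> c).
Proof.
move=> H; split; first exact: finite_measure_integrable_cst.
move=> B mB; rewrite H// integral_cst// muleC; congr (_ * _)%E.
exact: marginal_model.
Qed.

Lemma regression_vector_model eps rho :
  signs R rho -> 0 <= eps <= 1 / 8 ->
  regression_vector (model L eps rho) (model_eta L eps rho).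
Proof.
by move=> s e l; apply: cond_prob_cst => B mB; exact: (@model_label _ _ B l true).
Qed.

Lemma fp_class_cst beta eps rho (y : L.-tuple bool) :
  signs R rho -> 0 <= eps <= 1 / 8 ->
  \sum_(l < L | tnth y l) (1 - label_prob L rho eps l) <= beta%:R ->
  fp_class beta (model L eps rho) (fun=> y).
Proof.
move=> s e yb; split; first exact: measurable_cst.
exists (fun l _ => if tnth y l then 1 - label_prob L rho eps l else 0).
split; last by apply: aeW => x; rewrite -big_mkcond.
move=> l; apply: cond_prob_cst => B mB; case: ifPn => yl.
  rewrite -(@model_label _ _ B l false)//; congr (model _ _ _ _).
  by apply/seteqP; split => z /= [Bz h]; split=> //; case: h.
rewrite mule0 -(measure0 (model L eps rho)); congr (model _ _ _ _).
by apply/seteqP; split => z //= [_ []].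
Qed.

(* Integrating the a.s. bound over the event that i and j are both predicted
   shows that this event is null. *)
Lemma fp_class_miss_pair beta eps rho f (i j : 'I_L) :
  signs R rho -> 0 <= eps <= 1 / 8 -> i != j ->
  beta%:R < (1 - label_prob L rho eps i) + (1 - label_prob L rho eps j) ->
  fp_class beta (model L eps rho) f ->
  1 <= miss f i + miss f j.
Proof.
move=> s e ij hij [mf [g [gP]]].
case=> N [mN N0 hN].
have mt l b := measurable_classifier_tnth l b mf.
set P := model L eps rho in gP hN *.
pose A := [set x | tnth (f x) i = true] `&` [set x | tnth (f x) j = true].
have mA : measurable A by exact: measurableI.
have mD : measurable (A `\` N) by exact: measurableD.
pose mu := fine (U (A `\` N)).
have muE : U (A `\` N) = mu%:E by rewrite fineK// fin_num_measure.
have Mmu : marginal P (A `\` N) = mu%:E by rewrite -muE; exact: marginal_model.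
have mu0 : 0 <= mu by rewrite -lee_fin -muE measure_ge0.
pose I l := (\int[marginal P]_(x in A `\` N) (g l x)%:E)%E.
have IE l : I l = P ((@feature R L @^-1` (A `\` N)) `&`
    [set z | tnth (f z.1) l = true /\ tnth z.2 l = false]).
  by case: (gP l) => _ /(_ _ mD).
have I0 l : (0 <= I l)%E by rewrite IE measure_ge0.
(* On [A] both labels are predicted, so a false positive just means that the label is 0, which is
   independent of the feature. *)
have Iij l : l = i \/ l = j -> I l = (mu * (1 - label_prob L rho eps l))%:E.
  move=> lij; rewrite IE EFinM -muE -(@model_label _ _ _ l false)//.
  congr (P _); apply/seteqP; split => z /=; first by case=> ? [].
  by move=> [[[h1 h2] h3] h4]; repeat split => //; case: lij => ->.
have le : (\sum_(l < L) I l <= (mu * beta%:R)%:E)%E.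
  rewrite /I -integral_sum//=; last first.
    by move=> l; apply: integrableS (proj1 (gP l)).
  rewrite mulrC EFinM -Mmu -integral_cst//.
  apply: le_integral => //.
  - apply: integrable_sum => // l _.
    by apply: integrableS (proj1 (gP l)).
  - exact: finite_measure_integrable_cst.
  - move=> x; rewrite inE => -[_ Nx]; rewrite sumEFin lee_fin.
    by apply/negPn/negP => h; apply: Nx; apply: hN => /= h'; rewrite h' in h.
have : (I i + I j <= (mu * beta%:R)%:E)%E.
  apply: le_trans le; rewrite (bigD1 i)//= leeD2l// (bigD1 j)/= 1?eq_sym//.
  by rewrite leeDl// sume_ge0.
rewrite !Iij; [|by right|by left]; rewrite -EFinD lee_fin => h.
(* A positive [mu] could be cancelled, contradicting the strict inequality [hij]. *)
have {}h : mu = 0 by nra.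
have UN : U N = 0%E.
  by rewrite -(marginal_model eps rho mN).
have UA : U A = 0%E.
  apply/eqP; rewrite -measure_le0.
  apply: (@le_trans _ _ (U (A `\` N `|` N))).
    apply: le_measure; rewrite ?inE//; first exact: measurableU.
    by move=> x Ax; have [Nx|Nx] := pselect (N x); [right|left].
  apply: (le_trans (measureU2 _ mD mN)); rewrite -[leRHS]adde0.
  have DN0 : (U (A `\` N) <= 0)%E by rewrite muE h.
  have UN0 : (U N <= 0)%E by rewrite UN.
  exact: leeD DN0 UN0.
(* The two miss events and the null set [A] cover the whole space. *)
have : (1%:E <= U [set x | tnth (f x) i = false] +
                U [set x | tnth (f x) j = false])%E.
  rewrite -(probability_setT U).
  apply: (@le_trans _ _ (U (([set x | tnth (f x) i = false] `|`
                             [set x | tnth (f x) j = false]) `|` A))).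
    apply: le_measure; rewrite ?inE//.
      by apply: measurableU => //; exact: measurableU.
    by move=> x _; rewrite /A/=; case: (tnth _ i); case: (tnth _ j); tauto.
  have mU : measurable ([set x | tnth (f x) i = false] `|`
                        [set x | tnth (f x) j = false]).
    exact: measurableU.
  apply: (le_trans (measureU2 _ mU mA)); rewrite -[leRHS]adde0.
  have UA0 : (U A <= 0)%E by rewrite UA.
  exact: leeD (measureU2 _ (mt i false) (mt j false)) UA0.
rewrite -lee_fin EFinD /miss !fineK ?fin_num_measure//; exact: mt.
Qed.


End Model.

(** * Optimal risks under both signs and the two-point lower bound *)

Section Minimax.
Context (R : realType) (L : nat).
Implicit Types (eps rho : R).
Let l0 : 'I_L.+2 := ord0.
Let l1 : 'I_L.+2 := lift ord0 ord0.

Lemma sum_label_prob rho eps (a : 'I_L.+2 -> R) :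
  \sum_l a l * label_prob L.+2 rho eps l =
  a l0 * (3 / 4) + a l1 * (1 / 4 - rho * eps).
Proof.
by rewrite 2!big_ord_recl/= big1 ?addr0// => i _; rewrite /label_prob/= mulr0.
Qed.

Lemma risk_modelSS eps rho f :
  signs R rho -> 0 <= eps <= 1 / 8 -> classifier f ->
  risk (model L.+2 eps rho) f =
  L.+2%:R^-1 * (miss f l0 * (3 / 4) + miss f l1 * (1 / 4 - rho * eps)).
Proof. by move=> s e mf; rewrite risk_model// sum_label_prob. Qed.

Lemma risk_model_ge0 eps rho f :
  signs R rho -> 0 <= eps <= 1 / 8 -> classifier f ->
  0 <= risk (model L.+2 eps rho) f.
Proof.
move=> s e mf; rewrite risk_model// mulr_ge0 ?invr_ge0// sumr_ge0// => l _.
have /andP[m0 _] := miss_bounds l mf.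
by have /andP[p0 _] := label_prob_bounds l s e; exact: mulr_ge0.
Qed.

(** Predicting labels 1 and 2 together costs [1/4 + (3/4 + eps) > 1] conditional false positives, so
    almost surely one of them is missed, and label 2 is the cheaper one to miss. *)
Lemma risk_lower_bound1 eps f : 0 < eps <= 1 / 8 ->
  fp_class 1 (model L.+2 eps 1) f ->
  L.+2%:R^-1 * (1 / 4 - eps) <= risk (model L.+2 eps 1) f.
Proof.
move=> e01 fp; have mf := proj1 fp; have /andP[e0 e8] := e01.
have s1 : signs R 1 by right.
have e : 0 <= eps <= 1 / 8 by rewrite ltW.
rewrite risk_modelSS// ler_wpM2l ?invr_ge0//.
have : 1 <= miss f l0 + miss f l1.
  apply: (fp_class_miss_pair s1 e _ _ fp) => //.
  by rewrite /label_prob/=; lra.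
have /andP[a0 a1] := miss_bounds l0 mf; have /andP[b0 b1] := miss_bounds l1 mf.
by move: (miss f l0) (miss f l1) a0 a1 b0 b1 => a b *; nra.
Qed.

(** Label probabilities decrease with the index, so this is the top-[k] prediction; it is optimal
    with [k = 1] for the sign 1 and with [k = 2] for the sign -1. *)
Definition first_labels (k : nat) : L.+2.-tuple bool := [tuple (l < k)%N | l < L.+2].

Lemma miss_cst (y : L.+2.-tuple bool) l :
  miss (fun=> y : L.+2.-tuple bool) l = if tnth y l then 0 else 1 :> R.
Proof.
rewrite /miss; case: (tnth y l).
  by rewrite (_ : [set _ | _] = set0) ?measure0//; apply/seteqP; split.
rewrite (_ : [set _ | _] = setT); last by apply/seteqP; split.
by rewrite probability_setT.
Qed.

Lemma risk_argmin_model1 eps : 0 < eps <= 1 / 8 ->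
  risk_argmin 1 (model L.+2 eps 1) (fun=> first_labels 1).
Proof.
move=> e01; have /andP[e0 e8] := e01.
have e : 0 <= eps <= 1 / 8 by rewrite ltW.
have s1 : signs R 1 by right.
split.
  apply: fp_class_cst => //.
  rewrite big_mkcond/= 2!big_ord_recl !tnth_mktuple/= big1 => [|i _].
    by rewrite /label_prob/=; lra.
  by rewrite tnth_mktuple.
move=> f /(risk_lower_bound1 e01); apply: le_trans.
rewrite risk_modelSS//; last exact: measurable_cst.
by rewrite !miss_cst !tnth_mktuple/= ler_wpM2l ?invr_ge0//; lra.
Qed.

(** Here labels 1 and 2 together cost [1/4 + (3/4 - eps) <= 1], and the remaining labels are never
    1, so nothing is missed. *)
Lemma risk_argmin_modelN1 eps : 0 < eps <= 1 / 8 ->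
  risk_argmin 1 (model L.+2 eps (-1)) (fun=> first_labels 2) /\
  risk (model L.+2 eps (-1)) (fun=> first_labels 2) = 0.
Proof.
move=> /andP[e0 e8].
have e : 0 <= eps <= 1 / 8 by rewrite ltW.
have s1 : signs R (-1) by left.
have r0 : risk (model L.+2 eps (-1)) (fun=> first_labels 2) = 0.
  rewrite risk_modelSS//; last exact: measurable_cst.
  by rewrite !miss_cst !tnth_mktuple/= !mul0r addr0 mulr0.
split; last exact: r0.
split.
  apply: fp_class_cst => //.
  rewrite big_mkcond/= 2!big_ord_recl !tnth_mktuple/= big1 => [|i _].
    by rewrite /label_prob/=; lra.
  by rewrite tnth_mktuple.
by move=> f [mf _]; rewrite r0; exact: risk_model_ge0.
Qed.

Lemma risk_argmin_model_neq0 eps rho : 0 < eps <= 1 / 8 -> signs R rho ->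
  risk_argmin 1 (model L.+2 eps rho) !=set0.
Proof.
move=> e [] ->; last by exists (fun=> first_labels 1); exact: risk_argmin_model1.
by exists (fun=> first_labels 2); exact: (proj1 (risk_argmin_modelN1 e)).
Qed.

Lemma two_point_excess (a b p q c : R) : c <= p -> q <= 0 -> a <= b ->
  c <= `|a - p| + `|b - q|.
Proof.
move=> cp q0 ab; have := ler_norm (b - q).
by have := lerNnormlW (lexx `|a - p|); lra.
Qed.

(** Label 2 is likelier under the sign -1, so the risk of any fixed classifier is at least as large
    there as under 1, while the optimal values are ordered the other way: 0 against at least
    [(1/4 - eps) / L.+2]. *)
Lemma excess_risk_sum eps (fstar : R -> measurableTypeR R -> L.+2.-tuple bool) f :
  0 < eps <= 1 / 8 ->
  (forall rho, signs R rho ->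
     risk_argmin 1 (model L.+2 eps rho) (fstar rho)) ->
  classifier f ->
  L.+2%:R^-1 * (1 / 4 - eps) <=
  `|risk (model L.+2 eps 1) f - risk (model L.+2 eps 1) (fstar 1)| +
  `|risk (model L.+2 eps (-1)) f - risk (model L.+2 eps (-1)) (fstar (-1))|.
Proof.
move=> e01 fs mf; have /andP[e0 e8] := e01.
have e : 0 <= eps <= 1 / 8 by rewrite ltW.
have s1 : signs R 1 by right.
have sN1 : signs R (-1) by left.
have h1 := risk_lower_bound1 e01 (proj1 (fs _ s1)).
have h2 : risk (model L.+2 eps (-1)) (fstar (-1)) <= 0.
  have [am <-] := risk_argmin_modelN1 e01.
  exact: (proj2 (fs _ sN1)) (proj1 am).
have h3 : risk (model L.+2 eps 1) f <= risk (model L.+2 eps (-1)) f.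
  rewrite !risk_modelSS// ler_wpM2l ?invr_ge0//.
  have /andP[b0 _] := miss_bounds l1 mf.
  by move: (miss f l1) b0 => b b0; nra.
exact: two_point_excess h1 h2 h3.
Qed.

Lemma minimax_lower_bound eps N fstar :
  0 < eps <= 1 / 16 -> (1 + 16 * eps) ^+ N <= 3 / 2 ->
  (forall rho, signs R rho ->
     risk_argmin 1 (model L.+2 eps rho) (fstar rho)) ->
  ((1 / (16 * L.+2%:R))%:E <=
     minimax_excess_risk N (signs R) (model L.+2 eps) fstar)%E.
Proof.
move=> /andP[e0 e16] kN fs.
have e01 : 0 < eps <= 1 / 8 by rewrite e0/=; lra.
have e : 0 <= eps <= 1 / 8 by rewrite ltW//=; lra.
have s1 : signs R 1 by right.
have sN1 : signs R (-1) by left.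
apply: le_ereal_inf_tmp => _ [fhat [cf mrisk] <-].
pose ex rho D : R := `|risk (model L.+2 eps rho) (fhat D) -
  risk (model L.+2 eps rho) (fstar rho)|.
set S := ereal_sup _.
have mex rho : signs R rho -> measurable_fun setT (ex rho).
  move=> s; apply: measurableT_comp => //.
  by apply: measurable_funB => //; exact: mrisk.
have ES rho : signs R rho ->
    (\int[iid_law N (model L.+2 eps rho)]_D (ex rho D)%:E <= S)%E.
  by move=> s; apply: ereal_sup_ubound; exists rho.
have ex0 rho D : (0 <= (ex rho D)%:E)%E by rewrite lee_fin normr_ge0.
have k0 : 0 <= (1 + 16 * eps) ^+ N by apply: exprn_ge0; lra.
(* Change of measure: both excess risks are then integrated under the law of sign 1, where their
   pointwise sum is bounded below. *)
have tens : (\int[iid_law N (model L.+2 eps 1)]_D (ex (-1) D)%:E <=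
    ((1 + 16 * eps) ^+ N)%:E *
    \int[iid_law N (model L.+2 eps (-1))]_D (ex (-1) D)%:E)%E.
  apply: ge0_le_integral_dominated => //.
    by apply: dominated_iid_law; [lra|exact: dominated_model].
  by apply/measurable_EFinP; exact: mex.
have low : ((L.+2%:R^-1 * (1 / 4 - eps))%:E <=
    \int[iid_law N (model L.+2 eps 1)]_D (ex 1 D)%:E +
    \int[iid_law N (model L.+2 eps 1)]_D (ex (-1) D)%:E)%E.
  rewrite -ge0_integralD//; last 2 first.
  - by apply/measurable_EFinP; exact: mex.
  - by apply/measurable_EFinP; exact: mex.
  rewrite -[leLHS]mule1 -(probability_setT (iid_law N (model L.+2 eps 1))).
  rewrite -integral_cst//; apply: ge0_le_integral => //=.
  - by move=> D _; rewrite lee_fin mulr_ge0 ?invr_ge0//; lra.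
  - by apply/measurable_EFinP; apply: measurable_funD; exact: mex.
  - by move=> D _; rewrite lee_fin; exact: excess_risk_sum.
have S0 : (0 <= S)%E by apply: le_trans (ES 1 s1); exact: integral_ge0.
have : ((L.+2%:R^-1 * (1 / 4 - eps))%:E <= S + (3 / 2)%:E * S)%E.
  apply: (le_trans low); apply: leeD; first exact: ES.
  apply: (le_trans tens); apply: lee_pmul; rewrite ?lee_fin//.
    exact: integral_ge0.
  exact: ES.
case: S S0 {ES} => [r||]//; rewrite ?leey// -EFinM -EFinD !lee_fin => r0 h.
rewrite invfM.
have : 0 < L.+2%:R^-1 :> R by rewrite invr_gt0.
move: (L.+2%:R^-1) h => c h c0.
(* With [eps <= 1/16] the bound reads [(3/16) * c <= (5/2) * r], hence [r >= (3/40) * c], which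
   exceeds [c / 16]. *)
by nra.
Qed.

End Minimax.

(** * Total variation, margin, smoothness, density and estimation of the regression vector *)

Section Properties.
Context (R : realType) (L : nat).
Implicit Types (eps rho : R).
Let l0 : 'I_L.+2 := ord0.
Let l1 : 'I_L.+2 := lift ord0 ord0.

(** The power is at most [expR (N%:R * (16 * eps)) <= expR (1 / 4)], and the quadratic bound gives
    [1 + 1/4 + 1/8 <= 3/2]. *)
Lemma expr_1D16eps_le eps N : 0 <= eps -> eps <= (64 * N.+1%:R)^-1 ->
  (1 + 16 * eps) ^+ N <= 3 / 2.
Proof.
move=> e0 eN; apply: (@le_trans _ _ (expR (N%:R * (16 * eps)))).
  rewrite expRM_natl lerXn2r ?nnegrE ?expR_ge0 ?expR_ge1Dx//; lra.
have h : N%:R * (16 * eps) <= (1 / 4).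
  have N1 : (0 : R) < 64 * N.+1%:R by rewrite mulr_gt0// ltr0n.
  have : eps * (64 * N.+1%:R) <= 1 by rewrite -ler_pdivlMr// div1r.
  have : 0 <= N%:R :> R by [].
  by rewrite -(natr1 N); move: (N%:R : R) => n n0; nra.
apply: (@le_trans _ _ (expR (1 / 4))); first by rewrite ler_expR.
by apply: le_trans (expR_le_1Dx2 _) _; rewrite ?expr2; lra.
Qed.

Lemma tv_dist_model eps N :
  0 <= eps <= 1 / 8 -> (1 + 16 * eps) ^+ N <= 3 / 2 ->
  (tv_dist (iid_law N (model L.+2 eps 1)) (iid_law N (model L.+2 eps (-1)))
    <= (1 / 2)%:E)%E.
Proof.
move=> e kN; have /andP[e0 _] := e.
have k0 : 0 <= 1 + 16 * eps by lra.
apply: (@le_trans _ _ ((1 + 16 * eps) ^+ N - 1)%:E); last by rewrite lee_fin; lra.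
apply: tv_dist_dominated.
- by apply: exprn_ege1; lra.
- by apply: dominated_iid_law => //; apply: dominated_model => //; [right|left].
- by apply: dominated_iid_law => //; apply: dominated_model => //; [left|right].
Qed.

(** Since [3/4 > 1/4 - rho * eps > 0], a sorting permutation must fix the first two labels; it can
    only shuffle the others, all of probability 0. *)
Lemma sorts_label_prob eps rho sigma x (i : 'I_L.+2) :
  signs R rho -> 0 <= eps <= 1 / 8 ->
  sorts (model_eta L.+2 eps rho) sigma ->
  label_prob L.+2 rho eps (sigma x i) = label_prob L.+2 rho eps i.
Proof.
move=> s /andP[e0 e8] /(_ x) srt; rewrite /model_eta in srt.
have re : - (1 / 8) <= rho * eps <= 1 / 8 by case: s => ->; lra.
have lb (k : nat) (l : 'I_L.+2) : val l = k -> label_prob L.+2 rho eps l =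
    match k with 0 => 3 / 4 | 1 => 1 / 4 - rho * eps | _ => 0 end.
  by rewrite /label_prob => ->.
have s0 : sigma x l0 = l0.
  (* Comparing rank 0 with the rank of label [l0] shows that the label of rank 0 has probability at
     least 3/4. *)
  have := srt l0 ((sigma x)^-1%g l0) isT; rewrite permKV (lb 0%N l0)//.
  rewrite /label_prob; case E : (val (sigma x l0)) => [|[|k]] h;
    [exact/val_inj|exfalso; lra|exfalso; lra].
have s1 : sigma x l1 = l1.
  have k0 : (l1 <= (sigma x)^-1%g l1)%N.
    rewrite lt0n; apply/eqP => h.
    have h' : (sigma x)^-1%g l1 = l0 by exact/val_inj.
    by move: s0; rewrite -h' permKV h'.
  have := srt _ _ k0; rewrite permKV (lb 1%N l1)//.
  rewrite /label_prob; case E : (val (sigma x l1)) => [|[|k]] h;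
    [|exact/val_inj|exfalso; lra].
  have : sigma x l1 = sigma x l0 by rewrite s0; exact/val_inj.
  by move/perm_inj.
case iE : (val i) => [|[|k]].
- by have -> : i = l0 by [exact/val_inj]; rewrite s0.
- by have -> : i = l1 by [exact/val_inj]; rewrite s1.
- rewrite (lb _ _ iE) /label_prob; case E : (val (sigma x i)) => [|[|k']] //.
    have : sigma x i = sigma x l0 by rewrite s0; exact/val_inj.
    by move/perm_inj => h; rewrite h in iE.
  have : sigma x i = sigma x l1 by rewrite s1; exact/val_inj.
  by move/perm_inj => h; rewrite h in iE.
Qed.

(** Three labels already cost [1/4 + (3/4 + rho * eps) + 1 > 1]. This empties the margin events with
    [k >= 3], where the gap between consecutive probabilities is 0. *)
Lemma Kmax_le2 eps rho sigma x :
  signs R rho -> 0 <= eps <= 1 / 8 ->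
  sorts (model_eta L.+2 eps rho) sigma ->
  (Kmax 1 (model_eta L.+2 eps rho) sigma x <= 2)%N.
Proof.
move=> s e srt; have /andP[e0 e8] := e.
apply/bigmax_leqP_seq => m; rewrite mem_index_iota => /andP[_ mL] hm.
rewrite leqNgt; apply/negP => m3; move: hm.
under eq_bigr do rewrite /model_eta (sorts_label_prob _ _ s e srt).
rewrite leNgt => /negP; apply.
pose l2 : 'I_L.+2 := inord 2.
have l2E : val l2 = 2%N by rewrite /= inordK//; exact: leq_trans m3 _.
rewrite (bigD1 l0)/=; last exact: leq_trans m3.
rewrite (bigD1 l1)/=; last by rewrite andbT; exact: leq_trans m3.
rewrite (bigD1 l2)/=; last by rewrite -!val_eqE/= l2E m3.
have : 0 <= \sum_(i < L.+2 | (i < m)%N && (i != l0) && (i != l1) && (i != l2))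
    (1 - label_prob L.+2 rho eps i).
  apply: sumr_ge0 => i _.
  by have /andP[_] := label_prob_bounds i s e; rewrite subr_ge0.
have -> : label_prob L.+2 rho eps l2 = 0 by rewrite /label_prob l2E.
have -> : label_prob L.+2 rho eps l0 = 3 / 4 by [].
have -> : label_prob L.+2 rho eps l1 = 1 / 4 - rho * eps by [].
by move: (\sum_(i < _ | _) _) => S; case: s => -> S0; lra.
Qed.

(* The sorted regression values do not depend on x, so that the margin event is
   either empty or everything; it is thus measurable even if sigma is not. *)
Lemma local_margin_model eps rho : signs R rho -> 0 <= eps <= 1 / 8 ->
  local_margin 1 (model L.+2 eps rho) (model_eta L.+2 eps rho) 8 1.
Proof.
move=> s e sigma srt delta d0 i j ji; have /andP[e0 e8] := e.
rewrite powRr1; last exact: ltW.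
pose K := \max_(1 <= m < L.+3 |
  \sum_(l < L.+2 | (l < m)%N) (1 - label_prob L.+2 rho eps l) <= 1) m.
have KE x : Kmax 1 (model_eta L.+2 eps rho) sigma x = K.
  apply: eq_bigl => m; congr (_ <= _).
  by apply: eq_bigr => l _; rewrite /model_eta (sorts_label_prob _ _ s e srt).
set A := [set x | _].
pose Q := label_prob L.+2 rho eps i - label_prob L.+2 rho eps j <= delta /\ K = i.+1.
have AQ x : A x = Q.
  by rewrite /A/= KE /model_eta !(sorts_label_prob _ _ s e srt).
have [q|nq] := pselect Q; last first.
  rewrite (_ : A = set0); last by apply/seteqP; split => x //; rewrite AQ.
  by rewrite measure0 lee_fin mulr_ge0// ltW.
rewrite (_ : A = setT); last by apply/seteqP; split => x //; rewrite AQ.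
rewrite probability_setT lee_fin.
case: q => h Ki; have := Kmax_le2 point s e srt; rewrite KE Ki.
rewrite /label_prob /= ji in h; move: h.
(* The gaps are [1/2 + rho * eps] for [k = 1] and [1/4 - rho * eps] for [k = 2], both at least 1/8,
   so [8 * delta >= 1]. *)
by case: (val i) => [|[|k]]//= h _; case: s h => ->; lra.
Qed.

(** For positive [eps] the sum is at most 1 only for the sign 1, so the exact value is what can be
    recorded for both signs. *)
Lemma sum_model_eta eps rho x :
  \sum_(l < L.+2) model_eta L.+2 eps rho l x = 1 - rho * eps.
Proof.
rewrite /model_eta; have := sum_label_prob rho eps (fun=> 1 : R) (L := L).
by under eq_bigr do rewrite mul1r; move=> ->; lra.
Qed.

Lemma derive1n_cst (c : R) n : exists c', derive1n n (cst c : R -> R) = cst c'.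
Proof.
elim: n => [|n [c' IH]]; first by exists c.
by exists 0; rewrite derive1nS IH; apply/funext => x; rewrite derive1_cst.
Qed.

Lemma model_eta_smooth eps rho (l : 'I_L.+2) n (x : R) :
  derivable (derive1n n (model_eta L.+2 eps rho l : R -> R)) x 1.
Proof.
have [c' h] := derive1n_cst (label_prob L.+2 rho eps l) n.
rewrite (_ : model_eta _ _ _ l = cst (label_prob L.+2 rho eps l))// h.
exact: derivable_cst.
Qed.

Lemma marginal_model_density eps rho :
  exists p : measurableTypeR R -> R,
    measurable_fun setT p /\ (forall x, 0 <= p x) /\
    closure ([set x | p x != 0] : set R) = `[0, 1]%classic /\
    forall A, measurable A ->
      (marginal (model L.+2 eps rho) A =
       \int[lebesgue_measure]_(x in A) (p x)%:E)%E.
Proof.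
exists (uniform_pdf 0 1); split; first exact: measurable_uniform_pdf.
split; first by move=> x; apply: uniform_pdf_ge0.
split; last by move=> A mA; rewrite marginal_model.
rewrite (_ : [set x | _] = `[0, 1]%classic); last first.
  apply/seteqP; split => x; rewrite /= in_itv/= /uniform_pdf; case: ifPn => //.
  by rewrite eqxx.
by apply/esym/closure_id; exact: itv_closed.
Qed.

Definition label_event (l : 'I_L.+2) : set (measurableTypeR R * L.+2.-tuple bool) :=
  [set z | tnth z.2 l = true].

Lemma measurable_label_event l : measurable (label_event l).
Proof.
have : measurable_fun setT
    (fun z : measurableTypeR R * L.+2.-tuple bool => tnth z.2 l).
  exact: (measurableT_comp (measurable_tnth l) measurable_snd).
by move=> /(_ measurableT [set true] I); rewrite setTI.
Qed.

Lemma model_label_event eps rho l : signs R rho -> 0 <= eps <= 1 / 8 ->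
  model L.+2 eps rho (label_event l) = (label_prob L.+2 rho eps l)%:E.
Proof.
move=> s e; have := model_label l true s e measurableT.
rewrite [X in (X * _)%E](probability_setT (uniform_prob (@ltr01 R))) mul1e => <-.
by congr (model _ _ _ _); apply/seteqP; split => z //= [].
Qed.

(** The regression functions are constant, so the frequency of each label, ignoring the feature,
    estimates them; the constants depend on neither [eps] nor [rho] nor [N]. *)
Lemma exponential_bound_empirical_freq eps rho N :
  (0 < N)%N -> signs R rho -> 0 <= eps <= 1 / 8 ->
  exponential_bound (model L.+2 eps rho) (model_eta L.+2 eps rho)
    (fun (D : N.-tuple _) l _ => empirical_freq R (label_event l) D) 2 8^-1 1.
Proof.
move=> N0 s e delta d0 l; apply: aeW => x; rewrite powRr1//.
apply: chernoff_empirical_freq => //; first exact: measurable_label_event.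
exact: model_label_event.
Qed.

Lemma measurable_empirical_freq N l :
  measurable_fun setT (fun z : N.-tuple (measurableTypeR R * L.+2.-tuple bool)%type *
    measurableTypeR R => empirical_freq R (label_event l) z.1).
Proof.
apply: measurable_funM => //; apply: measurable_sum => i.
have mi : measurable_fun setT (\1_(label_event l) : _ -> R).
  by apply: measurable_indic; exact: measurable_label_event.
exact: (measurableT_comp mi (measurableT_comp (measurable_tnth i) measurable_fst)).
Qed.

End Properties.

(** * Choice of the rate and assembly of the statement *)

Lemma inv_increasing_bounds (R : realType) (phi : nat -> R) :
  (forall N, (1 <= N)%N -> 0 < phi N) ->
  (forall M N, (1 <= M)%N -> (M < N)%N -> phi M < phi N) ->
  (phi 1%N)^-1 <= 1 / 8 ->
  forall N, (1 <= N)%N -> 0 < (phi N)^-1 <= 1 / 8.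
Proof.
move=> phi0 phiS phi1 N N1; rewrite invr_gt0 phi0//=.
apply: le_trans phi1; rewrite lef_pV2 ?posrE ?phi0//.
by move: N1; rewrite leq_eqVlt => /orP[/eqP <-//|/phiS/ltW]; exact.
Qed.

Theorem mainTheorem3 (R : realType) (L : nat) (hL : (2 <= L)%N) :
  (exists r : nat -> R, (forall N, 0 < r N) /\
    forall phi : nat -> R,
      (forall N, (1 <= N)%N -> 0 < phi N) ->
      (forall M N, (1 <= M)%N -> (M < N)%N -> phi M < phi N) ->
      (phi 1%N)^-1 <= 1 / 8 ->
      (forall N, (1 <= N)%N -> (phi N)^-1 <= r N) ->
      forall N, (1 <= N)%N ->
        (tv_dist (iid_law N (model L (phi N)^-1 1))
                 (iid_law N (model L (phi N)^-1 (-1))) <= (1 / 2)%:E)%E /\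
        (forall rho, signs R rho ->
           risk_argmin 1 (model L (phi N)^-1 rho) !=set0) /\
        (forall fstar : R -> measurableTypeR R -> L.-tuple bool,
           (forall rho, signs R rho ->
              risk_argmin 1 (model L (phi N)^-1 rho) (fstar rho)) ->
           ((1 / (16 * L%:R))%:E <=
            minimax_excess_risk N (signs R) (model L (phi N)^-1) fstar)%E)) /\
  (forall phi : nat -> R,
      (forall N, (1 <= N)%N -> 0 < phi N) ->
      (forall M N, (1 <= M)%N -> (M < N)%N -> phi M < phi N) ->
      (phi 1%N)^-1 <= 1 / 8 ->
      (forall N rho, (1 <= N)%N -> signs R rho ->
         regression_vector (model L (phi N)^-1 rho) (model_eta L (phi N)^-1 rho) /\
         (forall (l : 'I_L) (n : nat) (x : R),
            derivable (derive1n n (model_eta L (phi N)^-1 rho l : R -> R)) x 1)) /\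
      (exists C0 alpha1 : R, 0 < C0 /\ 0 < alpha1 /\
         forall N rho, (1 <= N)%N -> signs R rho ->
           local_margin 1 (model L (phi N)^-1 rho) (model_eta L (phi N)^-1 rho)
             C0 alpha1) /\
      (forall N, (1 <= N)%N ->
         sparse 1 (model L (phi N)^-1 1) (model_eta L (phi N)^-1 1)) /\
      (forall N rho, (1 <= N)%N -> signs R rho ->
         {ae marginal (model L (phi N)^-1 rho), forall x,
            \sum_(l < L) model_eta L (phi N)^-1 rho l x = 1 - rho * (phi N)^-1}) /\
      (forall N rho, (1 <= N)%N -> signs R rho ->
         exists p : measurableTypeR R -> R,
           measurable_fun setT p /\ (forall x, 0 <= p x) /\
           closure ([set x | p x != 0] : set R) = `[0, 1]%classic /\
           forall A, measurable A ->
             (marginal (model L (phi N)^-1 rho) A =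
              \int[lebesgue_measure]_(x in A) (p x)%:E)%E) /\
      (exists (etahat : forall N,
                 N.-tuple (measurableTypeR R * L.-tuple bool)%type ->
                 'I_L -> measurableTypeR R -> R) (C1 C2 gamma : R),
         (forall N l, measurable_fun setT
            (fun z : N.-tuple (measurableTypeR R * L.-tuple bool)%type *
                     measurableTypeR R => etahat N z.1 l z.2)) /\
         0 < C1 /\ 0 < C2 /\ 0 < gamma /\
         forall N rho, (1 <= N)%N -> signs R rho ->
           exponential_bound (model L (phi N)^-1 rho)
             (model_eta L (phi N)^-1 rho) (etahat N) C1 C2 gamma)).
Proof.
case: L hL => [|[|L']] // _.
split.
  (* This rate keeps the tensorized constant below 3/2 and also yields [eps <= 1/16]; the successor
     makes it positive at [N = 0]. *)
  exists (fun N => (64 * N.+1%:R)^-1); split.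
    by move=> N; rewrite invr_gt0 mulr_gt0// ltr0n.
  move=> phi phi0 phiS phi1 phir N N1.
  have e01 := inv_increasing_bounds phi0 phiS phi1 N1.
  have e : 0 <= (phi N)^-1 <= 1 / 8 by case/andP: e01 => /ltW -> ->.
  have kN : (1 + 16 * (phi N)^-1) ^+ N <= 3 / 2.
    by apply: expr_1D16eps_le; [case/andP: e|exact: phir].
  split; first exact: tv_dist_model.
  split; first by move=> rho s; exact: risk_argmin_model_neq0.
  move=> fstar fs; apply: minimax_lower_bound => //.
  case/andP: e01 => -> _ /=; apply: (le_trans (phir _ N1)).
  rewrite div1r lef_pV2 ?posrE ?mulr_gt0 ?ltr0n//.
  by apply: (@le_trans _ _ (64 * 1)); [lra|rewrite ler_wpM2l// ler1n].
move=> phi phi0 phiS phi1.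
have e N : (1 <= N)%N -> 0 <= (phi N)^-1 <= 1 / 8.
  by move=> N1; case/andP: (inv_increasing_bounds phi0 phiS phi1 N1) => /ltW -> ->.
split.
  move=> N rho N1 s; split; first by apply: regression_vector_model => //; exact: e.
  by move=> l n x; exact: model_eta_smooth.
split.
  exists 8, 1; do 2 (split; first by []).
  by move=> N rho N1 s; apply: local_margin_model => //; exact: e.
split.
  move=> N N1; split => //; apply: aeW => x; rewrite sum_model_eta mul1r.
  by have /andP[e0 _] := e N N1; rewrite lerBlDr lerDl.
split; first by move=> N rho N1 s; apply: aeW => x; exact: sum_model_eta.
split; first by move=> N rho N1 s; exact: marginal_model_density.
exists (fun N D l _ => empirical_freq R (label_event l) D), 2, 8^-1, 1.
split; first by move=> N l; exact: measurable_empirical_freq.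
do 2 (split; first by []); split; first by [].
by move=> N rho N1 s; apply: exponential_bound_empirical_freq => //; exact: e.
Qed.
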